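(* Let $n,M\ge 1$, $\mathcal{X}\subseteq\mathbb{R}^n$, $h:\mathbb{R}^n\to\mathbb{R}\cup\{+\infty\}$, $g:\mathbb{R}^n\to\mathbb{R}\cup\{+\infty\}$, $f_1,\dots,f_M:\mathcal{X}\to\mathbb{R}$ and $L>0$, and set $F=\frac1M\sum_{i=1}^M f_i+g$. Suppose that: $h$ is proper, lower semi-continuous, convex and of Legendre type, with $\operatorname{dom} h=\mathcal{X}$; $\mathcal{X}$ is closed and convex with non-empty interior; $g$ is proper, lower semi-continuous and convex, with $\operatorname{dom} g\cap\operatorname{int}\mathcal{X}\ne\emptyset$; the minimizers of $F$ over $\mathcal{X}$ form a non-empty compact set in $\mathcal{X}$; for every $i=1,\dots,M$, $f_i$ is proper, lower semi-continuous, convex, and differentiable on $\operatorname{int}\operatorname{dom} h$, and $Lh-f_i$ is convex on $\operatorname{int}\operatorname{dom} h$; for any $x\in\operatorname{dom} h$ and $t\in\mathbb{R}$, the set $\{y\in\operatorname{int}\operatorname{dom} h: D_h(x,y)\le t\}$ is bounded, where $D_h(x,y)=h(x)-h(y)-\langle\nabla h(y),x-y\rangle$, and, for $x\in\operatorname{dom} h$ and a sequence $(x^k)$ in $\operatorname{int}\operatorname{dom} h$, $x^k\to x$ if and only if $D_h(x,x^k)\to 0$. Suppose also that the workers have finite answering time, i.e. the epoch index $m$ of iteration $k$ (epochs being defined in the context) tends to $+\infty$ as $k\to+\infty$, and fix $\gamma\in(0,1/L)$. If the problem $\min_{x\in\mathcal{X}} F(x)$ has a unique minimizer $x^\star$,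 then the sequence $(x^k)$ generated by the asynchronous Bregman proximal-gradient algorithm described in the context converges to $x^\star$.
   Context: **Problem.** $\min_{x\in\mathcal{X}} F(x):=\frac1M\sum_{i=1}^M f_i(x)+g(x)$, where $\mathcal{X}\subseteq\mathbb{R}^n$, $f_i:\mathcal{X}\to\mathbb{R}$ for $i=1,\dots,M$, and $g:\mathbb{R}^n\to\mathbb{R}\cup\{+\infty\}$. **Bregman regularizer.** $h:\mathbb{R}^n\to\mathbb{R}\cup\{+\infty\}$ is proper, lower semi-continuous and convex; $\operatorname{dom} h=\mathcal{X}$; and $h$ is of Legendre type, i.e. $h$ is differentiable and strictly convex on $\operatorname{int}\operatorname{dom} h$, with $\|\nabla h(x^k)\|\to+\infty$ for every sequence $(x^k)$ of $\operatorname{int}\operatorname{dom} h$ converging to a boundary point of $\operatorname{dom} h$. **Bregman distance.** For $x\in\operatorname{dom} h$ and $y\in\operatorname{int}\operatorname{dom} h$, $D_h(x,y)=h(x)-h(y)-\langle\nabla h(y),x-y\rangle$. **Assumptions on the problem.** (i) $\mathcal{X}$ is closed and convex with non-empty interior; (ii) $g$ is proper, lower semi-continuous, convex, with $\operatorname{dom} g\cap\operatorname{int}\mathcal{X}\ne\emptyset$; (iii) the minimizers of $F$ over $\mathcal{X}$ form a non-empty compact set in $\mathcal{X}$. **Functions $f_i$.** For every $i=1,\dots,M$: (i) $f_i$ is proper, lower semi-continuous and convex; (ii) $f_i$ is differentiable on $\operatorname{int}\operatorname{dom} h$; (iii) $f_i$ is $L$-smooth with respect to $h$, i.e. $Lh-f_i$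 is convex on $\operatorname{int}\operatorname{dom} h$. **Level boundedness and limit.** For any $x\in\operatorname{dom} h$ and $t\in\mathbb{R}$, the set $\{y\in\operatorname{int}\operatorname{dom} h: D_h(x,y)\le t\}$ is bounded. In addition, for $x\in\operatorname{dom}h$ and a sequence $(x^k)$ in $\operatorname{int}\operatorname{dom} h$, $x^k\to x$ if and only if $D_h(x,x^k)\to 0$. **Communication pattern and delays.** A central machine interacts with $M$ workers. At each iteration $k=1,2,\dots$ exactly one worker $i(k)\in\{1,\dots,M\}$ exchanges with the central machine (it delivers its computation and receives the new point $x^k$ in return). At time $0$ all workers receive the initial point $x^0$; this counts as an exchange of every worker at time $0$. For a worker $i$ and a time $k$, $d_i^k$ is the number of iterations since worker $i$ last exchanged with the central machine, so that $k-d_i^k$ is the largest exchange time of worker $i$ that is $\le k$ (in particular $d_{i(k)}^k=0$). The second-order delay is $D_i^k=d_i^k+d_i^{k-d_i^k-1}+1$, so that $k-D_i^k$ is the second-last exchange time of worker $i$ (the largest exchange time of $i$ strictly less than $k-d_i^k$); if worker $i$ has not exchanged at any of the times $1,\dots,k$, by convention $D_i^k=k$, i.e. $k-D_i^k=0$. **Algorithm.** Choose $x^0\in\operatorname{int}\operatorname{dom} h$ and, for $k\ge1$, set $$x^k=\operatorname*{argmin}_{x\in\mathcal{X}}\left\{\gamma g(x)+h(x)+\left\langle x,\ \frac1M\sum_{i=1}^M\left(\gamma\nabla f_i(x^{k-D_i^k})-\nabla h(x^{k-D_i^k})\right)\right\rangle\right\}.$$ **Epochs and worker participation.** Set $k_0=0$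 and, for $m\ge1$, let $k_m$ be the first iteration at which every worker has completed at least one full interaction since $k_{m-1}$, i.e. $k_m$ is the smallest $k\ge1$ such that every worker $i$ has exchanged at least once among the times $1,\dots,k$ and $k-D_i^k\ge k_{m-1}$ for all $i=1,\dots,M$. Iteration $k$ belongs to epoch $m$ if $k_m\le k<k_{m+1}$. Worker participation assumption: the workers have finite answering time, in other words the epoch index $m$ of iteration $k$ tends to $+\infty$ as $k\to+\infty$ (equivalently, $k_m<+\infty$ for all $m$). No bound on the delays is assumed. *)

(* Defs.v *)
(* Points of R^n are row vectors 'rV[R]_n. Their library norm is the sup norm,
   which is equivalent to the Euclidean one: boundedness, convergence and
   divergence of norms to +oo have their usual meaning. *)
From HB Require Import structures.
From mathcomp Require Import all_boot all_order all_algebra.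
From mathcomp Require Import all_classical all_reals all_analysis.

Set Implicit Arguments.
Unset Strict Implicit.
Unset Printing Implicit Defensive.

Import Order.TTheory GRing.Theory Num.Theory.
Import numFieldNormedType.Exports.

Local Open Scope classical_set_scope.
Local Open Scope ring_scope.

Section ConvexAnalysis.
Context {R : realType} {n : nat}.
Local Notation V := 'rV[R]_n.
Implicit Types (phi : V -> \bar R) (A : set V).

Definition edom phi : set V := [set x | (phi x < +oo)%E].

Definition eproper phi : Prop :=
  (forall x, phi x != -oo%E) /\ (edom phi !=set0).

(* Only meaningful for phi that never take the value -oo; in the library
   0 * +oo = 0, so t = 0 and t = 1 are harmless. *)
Definition econvex phi : Prop :=
  forall (x y : V) (t : R), 0 <= t <= 1 ->
    (phi (t *: x + (1 - t) *: y)%R <= t%:E * phi x + (1 - t)%:E * phi y)%E.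

(* The extended-real function attached to f : A -> R: it is +oo outside A, so
   that the values of f outside A are irrelevant. *)
Definition extend A (f : V -> R) : V -> \bar R :=
  patch (fun=> +oo%E) A (EFin \o f).

Definition strictly_convex_on A (f : V -> R) : Prop :=
  forall (x y : V) (t : R), A x -> A y -> x != y -> 0 < t < 1 ->
    f (t *: x + (1 - t) *: y) < t * f x + (1 - t) * f y.

Definition dotp (u v : V) : R := \sum_(j < n) u 0 j * v 0 j.

(* Junk where f is not differentiable. *)
Definition grad (f : V -> R) (x : V) : V :=
  \row_(j < n) 'D_(delta_mx 0 j) f x.

Definition boundary A : set V := closure A `\` A°.

Definition argmin A phi : set V :=
  [set x | A x /\ forall y, A y -> (phi x <= phi y)%E].

(* h is finite on its domain, where fine \o h is h as a real function. *)
Definition legendre_type (h : V -> \bar R) : Prop :=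
  [/\ forall x, (edom h)° x -> differentiable (fine \o h) x,
      strictly_convex_on (edom h)° (fine \o h) &
      forall (u : nat -> V) (x : V),
        (forall k, (edom h)° (u k)) -> boundary (edom h) x ->
        u @ \oo --> x ->
        `|grad (fine \o h) (u k)| @[k --> \oo] --> +oo].

Definition bregman (h : V -> \bar R) (x y : V) : R :=
  fine (h x) - fine (h y) - dotp (grad (fine \o h) y) (x - y).

Definition bregman_level_bounded (h : V -> \bar R) : Prop :=
  forall (x : V) (t : R), edom h x ->
    bounded_set [set y | (edom h)° y /\ bregman h x y <= t].

Definition bregman_limit (h : V -> \bar R) : Prop :=
  forall (x : V) (u : nat -> V), edom h x -> (forall k, (edom h)° (u k)) ->
    (u @ \oo --> x) <-> (bregman h x (u k) @[k --> \oo] --> (0 : R)).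

End ConvexAnalysis.

(* c k is the worker exchanging with the central machine at iteration k >= 1;
   the value c 0 is irrelevant, since every worker exchanges at time 0. *)
Section Asynchrony.
Variables (M : nat) (c : nat -> 'I_M).
Local Open Scope nat_scope.

Definition exchanges (i : 'I_M) (k : nat) : bool := (k == 0) || (c k == i).

Definition last_exchange (i : 'I_M) (k : nat) : nat :=
  \max_(j < k.+1 | exchanges i j) j.

Definition delay (i : 'I_M) (k : nat) : nat := k - last_exchange i k.

Definition has_answered (i : 'I_M) (k : nat) : bool :=
  [exists j : 'I_k.+1, (0 < j) && (c j == i)].

Definition delay2 (i : 'I_M) (k : nat) : nat :=
  if has_answered i k then delay i k + delay i (k - delay i k - 1) + 1 else k.

Definition full_round (a k : nat) : Prop :=
  1 <= k /\ forall i : 'I_M, has_answered i k /\ a <= k - delay2 i k.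

(* epoch_start m k means that k_m exists (is finite) and equals k. *)
Fixpoint epoch_start (m k : nat) : Prop :=
  if m is m'.+1 then
    exists2 a, epoch_start m' a &
      full_round a k /\ forall l, full_round a l -> k <= l
  else k = 0.

(* k_m <= k < k_(m+1), where k_(m+1) = +oo if it does not exist. *)
Definition in_epoch (m k : nat) : Prop :=
  (exists2 a, epoch_start m a & a <= k) /\
  (forall b, epoch_start m.+1 b -> k < b).

(* Every iteration is in exactly one epoch, so that e is determined by c. *)
Definition finite_answering_time : Prop :=
  exists2 e : nat -> nat, (forall k, in_epoch (e k) k) & e @ \oo --> \oo.

End Asynchrony.

Section Algorithm.
Context {R : realType} {n M : nat}.
Local Notation V := 'rV[R]_n.
Variables (X : set V) (h g : V -> \bar R) (f : 'I_M -> V -> R).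

Definition objective (x : V) : \bar R :=
  ((M%:R^-1 * \sum_(i < M) f i x)%R%:E + g x)%E.

Definition update_direction (gamma : R) (c : nat -> 'I_M) (x : nat -> V)
    (k : nat) : V :=
  M%:R^-1 *: \sum_(i < M)
    (gamma *: grad (f i) (x (k - delay2 c i k)%N)
       - grad (fine \o h) (x (k - delay2 c i k)%N)).

Definition async_bregman_prox_grad (gamma : R) (c : nat -> 'I_M)
    (x : nat -> V) : Prop :=
  (edom h)° (x 0%N) /\
  forall k, (0 < k)%N ->
    argmin X (fun y => gamma%:E * g y + h y
                + (dotp y (update_direction gamma c x k))%:E)%E (x k).

End Algorithm.

(* Main.v *)
Require Import Defs.
From HB Require Import structures.
From mathcomp Require Import all_boot all_order all_algebra.
From mathcomp Require Import all_classical all_reals all_analysis.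
From mathcomp Require Import zify lra ring.

Import Order.TTheory GRing.Theory Num.Theory.
Import numFieldNormedType.Exports.

Local Open Scope classical_set_scope.
Local Open Scope ring_scope.

(** Let D be the Bregman distance of h, p i k = k - delay2 c i k the time of the
    data of worker i used at iteration k, and a k = D (xstar, x k).

    One step.  The optimality condition of the proximal step is an inequality
    at every point y where F is finite.  Each worker contributes to it through
    the three-point identity of D, the convexity of f_i and the relative
    smoothness of f_i with constant L.  As gamma * L < 1, the terms in
    D (x k, x (p i k)) have the right sign and, at y = xstar, the average over
    the workers gives
      a k + gamma * (F (x k) - F xstar) <= average over i of a (p i k).
    No decrease from one step to the next follows, but a k is dominated by an
    average of older values.

    From one step to convergence.  The participation assumption makes every
    p i k tend to infinity with k ([sub_delay2_unbounded]).  So if a <= s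
    eventually, then a + b <= s eventually, with b k the gap
    gamma * (F (x k) - F xstar): either the gap at k is at least d and
    a k <= s - d, or the gap is smaller than d.  In the second case a k is
    small: the iterates are bounded because a <= a 0 and D has bounded level
    sets, and a bounded sequence whose gap tends to 0 accumulates only at
    minimizers, by lower semicontinuity, hence tends to xstar
    ([minimizing_sequence_cvg]); there D (xstar, .) tends to 0.  Lowering s by d
    repeatedly gives a --> 0 ([delayed_mean_cvg0]), that is, x --> xstar.

    All this needs the iterates to stay in the interior of dom h, where h has
    a gradient.  This is where Legendre type enters ([prox_interior]): towards a
    boundary minimizer the gradient of h would blow up, whereas
    minimality bounds it along a segment to an interior point. *)

(** * Exchange times *)

Section Exchanges.
Context {M : nat} (c : nat -> 'I_M).
Implicit Types (i : 'I_M) (k l : nat).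
Local Open Scope nat_scope.

Lemma last_exchange_le i k : last_exchange c i k <= k.
Proof. by apply/bigmax_leqP => j _; rewrite -ltnS. Qed.

Lemma last_exchange_homo i : {homo last_exchange c i : k l / k <= l}.
Proof.
move=> k l kl; apply/bigmax_leqP => j cj.
have jl : j < l.+1 by apply: leq_trans (ltn_ord j) _.
exact: (@leq_bigmax_cond _ (fun j : 'I_l.+1 => exchanges c i j) val
  (Ordinal jl)).
Qed.

Lemma has_answered_gt0 i k : has_answered c i k -> 0 < last_exchange c i k.
Proof.
case/existsP => j /andP[j0 cj]; apply: leq_trans j0 _.
apply: (@leq_bigmax_cond _ (fun j : 'I_k.+1 => exchanges c i j) val j).
by rewrite /exchanges cj orbT.
Qed.

Lemma has_answered_homo i k l :
  k <= l -> has_answered c i k -> has_answered c i l.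
Proof.
move=> kl /existsP[j jP]; apply/existsP.
have jl : j < l.+1 by apply: leq_trans (ltn_ord j) _.
by exists (Ordinal jl).
Qed.

(** The two nested delays, and the convention for workers that never answered,
    reduce to one iterated use of [last_exchange]; this makes monotonicity in k
    visible. *)
Lemma sub_delay2E i k : k - delay2 c i k =
  if has_answered c i k then last_exchange c i (last_exchange c i k).-1 else 0.
Proof.
rewrite /delay2 /delay; case: ifPn => [/has_answered_gt0|_]; last exact: subnn.
have := last_exchange_le i k.
have := last_exchange_le i (last_exchange c i k).-1.
move: (last_exchange c i k) => l le1 lk l0.
rewrite subKn// subn1; lia.
Qed.

Lemma sub_delay2_homo i k l : k <= l -> k - delay2 c i k <= l - delay2 c i l.
Proof.
move=> kl; rewrite !sub_delay2E; case: ifPn => // ak.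
rewrite (has_answered_homo _ _ _ kl ak); apply/last_exchange_homo.
have := last_exchange_homo i _ _ kl; lia.
Qed.

Lemma sub_delay2_lt i k : 0 < k -> k - delay2 c i k < k.
Proof. by move=> k0; rewrite ltn_subrL k0 andbT /delay2; case: ifP; lia. Qed.

(** A full round from a ends strictly after a, since a <= k - delay2 c i k < k
    for any worker i, such as c 0. *)
Lemma epoch_start_ge m k : epoch_start c m k -> m <= k.
Proof.
elim: m k => [|m IH] k //= [a /IH ma [[k1 /(_ (c 0))[_ ak]] _]].
by apply: leq_ltn_trans ma _; apply: leq_ltn_trans ak _; exact: sub_delay2_lt.
Qed.

(** At the start of epoch m.+1 all data are at least as recent as the start of
    epoch m, and by monotonicity this persists at later times. *)
Lemma sub_delay2_unbounded : finite_answering_time c ->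
  forall N, exists K, forall i k, K <= k -> N <= k - delay2 c i k.
Proof.
case=> e eP eoo N.
have /eoo[k _ /(_ k (leqnn k)) /= Nek] := nbhs_infty_ge N.+1.
case: (eP k) => -[]; case: (e k) Nek => // m mN a [b /epoch_start_ge mb].
case=> -[_ bP] _ _ _; exists a => i l al.
by have := sub_delay2_homo i _ _ al; have := (bP i).2; lia.
Qed.

End Exchanges.

(** * Sequences dominated by delayed averages *)

Section DelayedAverage.
Context {R : realType} {M : nat}.

Lemma average_le (u : 'I_M -> R) (s : R) :
  (0 < M)%N -> (forall i, u i <= s) -> M%:R^-1 * \sum_(i < M) u i <= s.
Proof.
move=> M0 ps; rewrite mulrC ler_pdivrMr ?ltr0n//.
apply: (le_trans (ler_sum _ (fun i _ => ps i))).
by rewrite sumr_const card_ord mulr_natr.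
Qed.

Lemma average_cst (s : R) : (0 < M)%N -> M%:R^-1 * \sum_(i < M) s = s.
Proof.
move=> M0; rewrite sumr_const card_ord -[s *+ M]mulr_natl mulKf//.
by rewrite pnatr_eq0 -lt0n.
Qed.

Lemma delayed_mean_bounded (a b : nat -> R) (p : 'I_M -> nat -> nat) :
  (0 < M)%N -> (forall k, (0 < k)%N -> 0 <= b k) ->
  (forall i k, (0 < k)%N -> (p i k < k)%N) ->
  (forall k, (0 < k)%N -> a k + b k <= M%:R^-1 * \sum_(i < M) a (p i k)) ->
  forall k, a k <= a 0%N.
Proof.
move=> M0 b0 plt ab; elim/ltn_ind => -[//|k] IH.
have avg := average_le _ _ M0 (fun i => IH _ (plt i _ (ltn0Sn k))).
by have := ab k.+1 isT; have := b0 k.+1 isT; lra.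
Qed.

(** The term b is a gain which forces a to be small when it is itself small. As
    the delays are unbounded, there is no rate: an eventual bound on a is only
    inherited by later indices, from some unspecified time on. *)
Lemma delayed_mean_cvg0 (a b : nat -> R) (p : 'I_M -> nat -> nat) :
  (0 < M)%N -> (forall k, 0 <= a k) -> (forall k, (0 < k)%N -> 0 <= b k) ->
  (forall i k, (0 < k)%N -> (p i k < k)%N) ->
  (forall N, exists K, forall i k, (K <= k)%N -> (N <= p i k)%N) ->
  (forall k, (0 < k)%N -> a k + b k <= M%:R^-1 * \sum_(i < M) a (p i k)) ->
  (forall e, 0 < e -> exists2 d, 0 < d &
     forall k, (0 < k)%N -> b k < d -> a k < e) ->
  a @ \oo --> (0 : R).
Proof.
move=> M0 a0 b0 plt poo ab ba; apply/cvgrPdist_le => e e0.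
have a_le := delayed_mean_bounded _ _ _ M0 b0 plt ab.
have [d d0 dP] := ba e e0.
(* One pass through the delays lowers the eventual bound by d, down to e. *)
have bnd n : exists K, forall k, (K <= k)%N ->
    a k <= Num.max (a 0%N - n%:R * d) e.
  elim: n => [|n [K KP]].
    by exists 0%N => k _; rewrite mul0r subr0 le_max a_le.
  have [K' K'P] := poo K; exists (maxn K' 1) => k.
  rewrite geq_max => /andP[K'k k0].
  have := ab k k0.
  have /= avg := average_le _ _ M0 (fun i => KP _ (K'P i k K'k)).
  have [/(dP _ k0)|dbk abk] := ltP (b k) d.
    by rewrite le_max => /ltW ->; rewrite orbT.
  move: (le_trans abk avg); rewrite !le_max -natr1 mulrDl mul1r.
  by case/orP => ?; apply/orP; [left|right]; lra.
have [K KP] := bnd (Num.truncn (a 0%N / d)).+1.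
exists K => // k /= /KP; rewrite sub0r normrN ger0_norm// le_max => /orP[|//].
have := truncnS_gt (a 0%N / d); rewrite ltr_pdivrMr// => lt le.
have := a0 k; lra.
Qed.
End DelayedAverage.

(** * Dot products and gradients *)

Section DotProduct.
Context {R : realType} {n : nat}.
Local Notation V := 'rV[R]_n.
Implicit Types (u v w : V) (a : R).

Lemma dotpDr u v w : dotp u (v + w) = dotp u v + dotp u w.
Proof. by rewrite -big_split; apply: eq_bigr => j _; rewrite mxE mulrDr. Qed.

Lemma dotpZr a u v : dotp u (a *: v) = a * dotp u v.
Proof. by rewrite mulr_sumr; apply: eq_bigr => j _; rewrite mxE mulrCA. Qed.

Lemma dotpBr u v w : dotp u (v - w) = dotp u v - dotp u w.
Proof. by rewrite dotpDr -scaleN1r dotpZr mulN1r. Qed.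

Lemma dotpC u v : dotp u v = dotp v u.
Proof. by apply: eq_bigr => j _; rewrite mulrC. Qed.

Lemma dotp_sumr (I : finType) u (v : I -> V) :
  dotp u (\sum_i v i) = \sum_i dotp u (v i).
Proof.
rewrite exchange_big; apply: eq_bigr => j _.
by rewrite summxE mulr_sumr.
Qed.

Lemma dotp_delta u j : dotp u (delta_mx 0 j) = u 0 j.
Proof.
rewrite /dotp (bigD1 j)//= mxE !eqxx mulr1 big1 ?addr0// => k kj.
by rewrite mxE (negbTE kj) andbF mulr0.
Qed.

Lemma row_norm_le v a : 0 <= a -> (forall j, `|v 0 j| <= a) -> `|v| <= a.
Proof.
move=> a0 va; change (mx_norm v <= a).
have [->//|/mx_norm_neq0[[i j] ->]] := eqVneq (mx_norm v) 0.
by rewrite (ord1 i).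
Qed.

End DotProduct.

Section Tangent.
Context {R : realType} {n : nat}.
Local Notation V := 'rV[R]_n.
Implicit Types (phi : V -> R) (w v y : V).

Lemma dotp_grad phi w v : differentiable phi w -> dotp (grad phi w) v = 'D_v phi w.
Proof.
move=> dphi; rewrite deriveE// [in RHS](row_sum_delta v) linear_sum.
by apply: eq_bigr => j _; rewrite mxE linearZ deriveE// mulrC.
Qed.

Lemma cvg_directional phi w y : differentiable phi w ->
  t^-1 * (phi (t *: y + (1 - t) *: w) - phi w) @[t --> 0^'+]
    --> dotp (grad phi w) (y - w).
Proof.
move=> dphi; rewrite dotp_grad//.
have /cvg_dnbhs_at_right := @diff_derivable _ _ _ _ _ (y - w) dphi.
apply: cvg_trans; apply: near_eq_cvg; near=> t => /=.
congr (_ * (phi _ - _)); rewrite scalerBr scalerBl scale1r.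
by rewrite addrAC -addrA.
Unshelve. all: by end_near. Qed.

Lemma near0_right_lt1 : \forall t \near (0 : R)^'+, 0 < t < 1.
Proof.
near=> t; apply/andP; split; near: t; first exact: nbhs_right_gt.
exact: nbhs_right_lt.
Unshelve. all: by end_near. Qed.

(** Stated along one segment, so as to apply to h and f on X as well as to
    L h - f on the interior of X. *)
Lemma convex_tangent_le phi w y : differentiable phi w ->
  (forall t, 0 < t < 1 ->
     phi (t *: y + (1 - t) *: w) <= t * phi y + (1 - t) * phi w) ->
  dotp (grad phi w) (y - w) <= phi y - phi w.
Proof.
move=> /(cvg_directional _ _ y) dphi cphi.
rewrite -(cvg_lim _ dphi)//; apply: limr_le; first exact: cvgP dphi.
near=> t; have t01 : 0 < t < 1 by near: t; exact: near0_right_lt1.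
have /andP[t0 _] := t01.
by rewrite ler_pdivrMl//; have := cphi t t01; lra.
Unshelve. all: by end_near. Qed.

(** Turns a lower bound on phi along a segment, such as the one that minimality
    gives, into a first-order optimality condition. *)
Lemma directional_derivative_ge phi w y c : differentiable phi w ->
  (forall t, 0 < t < 1 -> phi w + t * c <= phi (t *: y + (1 - t) *: w)) ->
  c <= dotp (grad phi w) (y - w).
Proof.
move=> /(cvg_directional _ _ y) dphi cphi.
rewrite -(cvg_lim _ dphi)//; apply: limr_ge; first exact: cvgP dphi.
near=> t; have t01 : 0 < t < 1 by near: t; exact: near0_right_lt1.
have /andP[t0 _] := t01.
by rewrite ler_pdivlMl//; have := cphi t t01; lra.
Unshelve. all: by end_near. Qed.

End Tangent.

(** * Extended-valued convex functions *)

Section ExtendedConvex.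
Context {R : realType} {n : nat}.
Local Notation V := 'rV[R]_n.
Implicit Types (phi : V -> \bar R) (x y z : V) (t : R).

Lemma edom_fin phi x : eproper phi -> edom phi x -> (fine (phi x))%:E = phi x.
Proof.
case=> pN _ px; rewrite fineK// fin_numE pN /=.
by move: px; rewrite /edom /= ltey.
Qed.

Lemma econvex_fine phi x y t : eproper phi -> econvex phi ->
  edom phi x -> edom phi y -> 0 <= t <= 1 ->
  edom phi (t *: x + (1 - t) *: y) /\
  fine (phi (t *: x + (1 - t) *: y)) <= t * fine (phi x) + (1 - t) * fine (phi y).
Proof.
move=> pphi cphi px py t01.
have := cphi x y t t01; rewrite -(edom_fin _ _ pphi px) -(edom_fin _ _ pphi py).
rewrite -!EFinM -EFinD /edom/= => le.
have dom : edom phi (t *: x + (1 - t) *: y) by apply: le_lt_trans le (ltry _).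
by split=> //; move: le; rewrite -(edom_fin _ _ pphi dom) lee_fin.
Qed.

(** The points t *: y + (1 - t) *: x with y in A fill a neighbourhood of the one
    obtained from the interior point z: the homothety of centre x and ratio t
    is invertible, with continuous inverse. *)
Lemma interior_segment (A : set V) x z t :
  (forall y, A y -> A (t *: y + (1 - t) *: x)) ->
  0 < t -> A° z -> A° (t *: z + (1 - t) *: x).
Proof.
move=> Ax t0 Az; pose back (q : V) := t^-1 *: (q - (1 - t) *: x).
have tn0 : t != 0 by rewrite gt_eqF.
have backK q : t *: back q + (1 - t) *: x = q.
  by rewrite /back scalerA divff// scale1r subrK.
have zE : back (t *: z + (1 - t) *: x) = z.
  by rewrite /back addrK scalerA mulVf// scale1r.
have cback : {for t *: z + (1 - t) *: x, continuous back}.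
  apply: (@continuousZ _ _ _ (cst t^-1)); first exact: cst_continuous.
  by apply: continuousB => //; exact: cst_continuous.
have /cback : nbhs (back (t *: z + (1 - t) *: x)) A by rewrite zE.
move=> nA.
suff: back @^-1` A `<=` A by move=> /filterS; exact.
by move=> q /Ax; rewrite backK.
Qed.

End ExtendedConvex.

(** * Bregman distances and relative smoothness *)

Section BregmanKernel.
Context {R : realType} {n : nat} (h : 'rV[R]_n -> \bar R).
Local Notation V := 'rV[R]_n.
Hypotheses (h_proper : eproper h) (h_convex : econvex h).
Hypothesis h_diff : forall x, (edom h)° x -> differentiable (fine \o h) x.
Implicit Types (x y z w p u : V) (f : V -> R).

Let X := edom h.

Lemma edom_conv x y t : X x -> X y -> 0 <= t <= 1 -> X (t *: x + (1 - t) *: y).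
Proof. by move=> Xx Xy /(econvex_fine _ _ _ _ h_proper h_convex Xx Xy)[]. Qed.

Lemma interior_conv x z t : X x -> X° z -> 0 < t <= 1 ->
  X° (t *: z + (1 - t) *: x).
Proof.
move=> Xx Xz /andP[t0 t1]; apply: interior_segment => // y Xy.
by apply: edom_conv => //; rewrite t1 ltW.
Qed.

Lemma bregman_ge0 x y : X x -> X° y -> 0 <= bregman h x y.
Proof.
move=> Xx Xy; rewrite /bregman subr_ge0; apply: convex_tangent_le.
  exact: h_diff.
move=> t t01; apply: (econvex_fine _ _ _ _ h_proper h_convex Xx _ _).2.
- exact: interior_subset Xy.
- by lra.
Qed.

Lemma three_point y p w :
  dotp (grad (fine \o h) p - grad (fine \o h) w) (y - p) =
  bregman h y w - bregman h y p - bregman h p w.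
Proof.
rewrite /bregman dotpC dotpBr !(dotpC (y - p)) !dotpBr; lra.
Qed.

(** This is the tangent inequality of the convex function L h - f at w. *)
Lemma descent_le (L : R) f y w : X° y -> X° w -> differentiable f w ->
  convex_function X° (fun x => L * fine (h x) - f x) ->
  f y <= f w + dotp (grad f w) (y - w) + L * bregman h y w.
Proof.
move=> Xy Xw df cLhf; set phi := fun x => L * fine (h x) - f x.
have dh := h_diff _ Xw.
have dphi : differentiable phi w.
  by apply: differentiableB => //; exact: differentiableZ.
have : dotp (grad phi w) (y - w) <= phi y - phi w.
  apply: convex_tangent_le => // t /andP[t0 t1].
  have t01 : Itv.spec (@Itv.num_sem R) (Itv.Real `[0%Z, 1%Z]) t.
    by rewrite /Itv.spec /= /Itv.num_sem /= in_itv/= num_real !ltW.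
  have /= := cLhf (Itv.mk t01) y w; rewrite !inE => /(_ Xy Xw).
  by [].
rewrite dotp_grad//.
have -> : 'D_(y - w) phi w =
    L * dotp (grad (fine \o h) w) (y - w) - dotp (grad f w) (y - w).
  rewrite !dotp_grad// /phi.
  rewrite [LHS](deriveB (f := L \*: (fine \o h))).
      by rewrite deriveZ//; exact: diff_derivable.
    by apply: diff_derivable; exact: differentiableZ.
  exact: diff_derivable.
rewrite /bregman /phi; lra.
Qed.

Lemma linearization_le f y w : eproper (extend X f) -> econvex (extend X f) ->
  X y -> X° w -> differentiable f w ->
  dotp (grad f w) (y - w) <= f y - f w.
Proof.
move=> pf cf Xy Xw df; apply: convex_tangent_le => // t t01.
have fE x : X x -> extend X f x = (f x)%:E.
  by move=> Xx; rewrite /extend /patch mem_set.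
have domf x : X x -> edom (extend X f) x by move=> Xx; rewrite /edom/= fE// ltry.
have Xw' := interior_subset Xw.
have t01' : 0 <= t <= 1 by lra.
have [_] := econvex_fine _ _ _ _ pf cf (domf _ Xy) (domf _ Xw') t01'.
by rewrite !fE//; exact: edom_conv.
Qed.

(** With w the delayed point of a worker, p the new iterate and y the point of
    comparison, split y - p as (y - w) - (p - w): convexity of f controls the
    first part and the descent inequality the second, at the cost of
    gamma * L * D (p, w), which the term - D (p, w) of the three-point identity
    absorbs since gamma * L < 1. *)
Lemma worker_progress_le (L gamma : R) f y p w :
  0 < gamma < 1 / L -> 0 < L ->
  eproper (extend X f) -> econvex (extend X f) ->
  convex_function X° (fun x => L * fine (h x) - f x) ->
  X y -> X° p -> X° w -> differentiable f w ->
  dotp (grad (fine \o h) p + (gamma *: grad f w - grad (fine \o h) w)) (y - p)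
  <=
  gamma * (f y - f p) + bregman h y w - bregman h y p.
Proof.
move=> /andP[g0 gL] L0 pf cf cLhf Xy Xp Xw df.
have D0 := bregman_ge0 _ _ (interior_subset Xp) Xw.
have gLD : gamma * (L * bregman h p w) <= bregman h p w.
  rewrite mulrA ler_piMl//; move: gL; rewrite ltr_pdivlMr// => /ltW; exact.
have up := descent_le _ _ _ _ Xp Xw df cLhf.
have lo := linearization_le _ _ _ pf cf Xy Xw df.
have yp : dotp (grad f w) (y - p) <= f y - f p + L * bregman h p w.
  have -> : y - p = (y - w) - (p - w) by rewrite opprB addrA subrK.
  by rewrite dotpBr; lra.
have gyp : gamma * dotp (grad f w) (y - p) <=
    gamma * (f y - f p + L * bregman h p w).
  by rewrite ler_pM2l.
rewrite addrCA dotpC dotpDr dotpZr dotpC (dotpC (y - p)) three_point.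
by move: gyp; rewrite mulrDr; lra.
Qed.

End BregmanKernel.

(** * The proximal step *)

Section ProximalStep.
Context {R : realType} {n : nat} (h g : 'rV[R]_n -> \bar R) (gamma : R).
Local Notation V := 'rV[R]_n.
Hypotheses (h_proper : eproper h) (h_convex : econvex h).
Hypothesis h_legendre : legendre_type h.
Hypotheses (g_proper : eproper g) (g_convex : econvex g).
Hypothesis gamma_gt0 : 0 < gamma.
Implicit Types (x y z w p u : V).

Let X := edom h.
Let h_diff : forall x, (edom h)° x -> differentiable (fine \o h) x.
Proof. by case: h_legendre. Qed.

Variables (u p z : V).
Hypothesis p_min :
  argmin X (fun y => gamma%:E * g y + h y + (dotp y u)%:E)%E p.
Hypotheses (gz : edom g z) (Xz : X° z).

Let modelE y : edom g y -> X y ->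
  (gamma%:E * g y + h y + (dotp y u)%:E)%E =
  (gamma * fine (g y) + fine (h y) + dotp y u)%:E.
Proof.
by move=> gy Xy; rewrite -(edom_fin _ _ g_proper gy) -(edom_fin _ _ h_proper Xy).
Qed.

Lemma prox_edom_g : edom g p.
Proof.
have [Xp /(_ z (interior_subset Xz))] := p_min.
rewrite (modelE z gz (interior_subset Xz)).
rewrite -(edom_fin _ _ h_proper Xp) /edom/=; have [gN _] := g_proper.
case: (g p) (gN p) => [r||] //= _; first by rewrite ltry.
by rewrite gt0_muley ?lte_fin.
Qed.

(** Only g is bounded by its convexity along the segment: h stays inside the
    inequality, whose difference quotients at p will give the optimality
    condition and which bounds the gradients of h near a boundary point p. *)
Lemma prox_segment_ge y t : edom g y -> X y -> 0 <= t <= 1 ->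
  fine (h p) + t * (gamma * (fine (g p) - fine (g y)) - dotp (y - p) u) <=
  fine (h (t *: y + (1 - t) *: p)).
Proof.
move=> gy Xy t01; have [Xp pmin] := p_min; have gp := prox_edom_g.
have [gt cgt] := econvex_fine _ _ _ _ g_proper g_convex gy gp t01.
have [Xt _] := econvex_fine _ _ _ _ h_proper h_convex Xy Xp t01.
have := pmin _ Xt; rewrite !modelE// lee_fin.
have : gamma * fine (g (t *: y + (1 - t) *: p)) <=
       gamma * (t * fine (g y) + (1 - t) * fine (g p)) by rewrite ler_pM2l.
rewrite !(dotpC _ u) dotpBr dotpDr !dotpZr; lra.
Qed.

(* Minimality forces the directional derivative of h along z - p to be at
   least slope at all points between z and p, see grad_le. *)
Let slope := gamma * (fine (g p) - fine (g z)) - dotp (z - p) u.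

(* The bound does not depend on the position t of w on the segment from p to z:
   this is what contradicts a blow-up of the gradient near p. *)
Let grad_le w y t : 0 < t <= 1 -> w = t *: z + (1 - t) *: p -> X y ->
  dotp (grad (fine \o h) w) (y - z) <= fine (h y) - fine (h p) - slope.
Proof.
move=> t01 wE Xy; have [Xp _] := p_min.
have Xw : X° w by rewrite wE; apply: interior_conv.
have := prox_segment_ge _ t gz (interior_subset Xz); rewrite -wE -/slope => lo.
have {}lo : fine (h p) + t * slope <= fine (h w) by apply: lo; lra.
have tangent x : X x ->
    dotp (grad (fine \o h) w) (x - w) <= fine (h x) - fine (h w).
  move=> Xx; have := bregman_ge0 _ h_proper h_convex h_diff _ _ Xx Xw.
  by rewrite subr_ge0.
have := tangent p Xp; have := tangent y Xy.
have -> : p - w = (- t) *: (z - p).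
  by rewrite wE; apply/rowP => j; rewrite !mxE; ring.
have -> : y - w = (y - z) + (1 - t) *: (z - p).
  by rewrite wE; apply/rowP => j; rewrite !mxE; ring.
rewrite dotpDr !dotpZr => ty tp.
have tz : slope <= dotp (grad (fine \o h) w) (z - p).
  have /andP[t0 _] := t01.
  rewrite -(ler_pM2l t0); lra.
have : (1 - t) * slope <= (1 - t) * dotp (grad (fine \o h) w) (z - p).
  by apply: ler_wpM2l => //; lra.
lra.
Qed.

(** If p were a boundary point, grad h would blow up along the segment from the
    interior point z to p. But grad_le bounds the gradients on that segment in
    every direction y - z with y in a ball around z, hence in norm. *)
Lemma prox_interior : X° p.
Proof.
have [Xp _] := p_min; apply: contrapT => Xp'.
pose w (k : nat) : V := k.+1%:R^-1 *: z + (1 - k.+1%:R^-1) *: p.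
have k01 k : 0 < (k.+1%:R^-1 : R) <= 1.
  by rewrite invr_gt0 ltr0n invf_le1 ?ltr0n ?ler1n.
have Xw k : X° (w k) by apply: interior_conv.
have wp : w @ \oo --> p.
  have i0 : (k.+1%:R^-1 : R) @[k --> \oo] --> (0 : R) by exact: cvg_harmonic.
  suff : w @ \oo --> 0 *: z + (1 - 0) *: p.
    by rewrite scale0r add0r subr0 scale1r.
  by apply: cvgD; apply: cvgZr_tmp => //; apply: cvgB => //; exact: cvg_cst.
have [_ _ blowup] := h_legendre.
have /cvgryPge grad_oo : `|grad (fine \o h) (w k)| @[k --> \oo] --> +oo.
  by apply: blowup wp => //; split => //; exact: subset_closure.
have hz : \forall y \near z, X y /\ fine (h y) <= fine (h z) + 1.
  near=> y; split; first by near: y; exact: Xz.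
  near: y; have := differentiable_continuous (h_diff _ Xz).
  by move=> /cvgr_le; apply; rewrite ltrDl.
have [r /= r0 rP] := (nbhs_ballP _ _).1 hz.
set C := fine (h z) + 1 - fine (h p) - slope.
have coord k j : `|grad (fine \o h) (w k) 0 j| <= C / (r / 2).
  (* Test the bound of grad_le at the points z +- (r / 2) e_j. *)
  have near_z s : `|s| = 1 -> s * (r / 2) * grad (fine \o h) (w k) 0 j <= C.
    move=> s1; pose y := z + (s * (r / 2)) *: delta_mx 0 j.
    have [Xy hy] : X y /\ fine (h y) <= fine (h z) + 1.
      apply: rP; rewrite -ball_normE/= /y opprD addrA subrr sub0r normrN normrZ.
      apply: le_lt_trans (_ : r / 2 * 1 < r); last by lra.
      rewrite normrM s1 mul1r ger0_norm; last lra.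
      apply: ler_wpM2l (row_norm_le _ _ _ _) => // [|i]; first by lra.
      by rewrite mxE; case: (_ && _); rewrite ?normr1 ?normr0.
    have := grad_le (w k) y _ (k01 k) erefl Xy.
    rewrite /y addrC addKr dotpZr dotp_delta.
    by move: hy; rewrite /y /C; lra.
  rewrite ler_pdivlMr; last lra.
  have [G0|G0] := ger0P (grad (fine \o h) (w k) 0 j).
    by have := near_z 1 (normr1 _); lra.
  by have := near_z (-1) (normrN1 _); lra.
set B := Num.max 0 (C / (r / 2)).
have [K _ /(_ K (leqnn K)) /= big] := grad_oo (B + 1).
have : `|grad (fine \o h) (w K)| <= B.
  apply: row_norm_le => [|j]; first by rewrite le_max lexx.
  by rewrite le_max coord orbT.
lra.
Unshelve. all: by end_near. Qed.

(** The inclusion - grad h p - u \in gamma * subdifferential of g at p, written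
    at y. *)
Lemma prox_optimality y : edom g y -> X y ->
  gamma * (fine (g p) - fine (g y)) <= dotp (grad (fine \o h) p + u) (y - p).
Proof.
move=> gy Xy; rewrite dotpC dotpDr !(dotpC (y - p)) (dotpC u) -lerBlDr.
apply: directional_derivative_ge; first by apply: h_diff; exact: prox_interior.
by move=> t t01; apply: prox_segment_ge => //; lra.
Qed.

End ProximalStep.

(** * Minimizing sequences *)

Section MinimizingSequence.
Context {R : realType} {n : nat}.
Local Notation V := 'rV[R]_n.

(** The sequence lives in a compact set, and its cluster points belong to X and
    are minimizers of Phi: so xs is its only cluster point. *)
Lemma minimizing_sequence_cvg (X : set V) (Phi : V -> \bar R) (xs : V)
    (B : set V) (y : nat -> V) :
  closed X ->
  (forall z (a : R), X z -> (a%:E < Phi z)%E ->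
     \forall v \near z, X v -> (a%:E < Phi v)%E) ->
  argmin X Phi = [set xs] -> Phi xs \is a fin_num ->
  bounded_set B -> (forall k, B (y k)) -> (forall k, X (y k)) ->
  (forall e, 0 < e -> \forall k \near \oo, (Phi (y k) <= Phi xs + e%:E)%E) ->
  y @ \oo --> xs.
Proof.
move=> Xcl lscPhi argminE finPhi [m0 [_ m0P]] By Xy yPhi.
have [m mP] : exists m, forall v, B v -> `|v| <= m.
  by exists (m0 + 1) => v; apply: m0P; rewrite ltrDl.
(* The term `|xs| + 1 makes the compact set a neighbourhood of xs. *)
pose K := [set v : V | `|v| <= Num.max m (`|xs| + 1)].
have Kcpt : compact K.
  apply: bounded_closed_compact.
    exists (Num.max m (`|xs| + 1)); split; first exact: num_real.
    by move=> c mc v Kv; apply: le_trans Kv (ltW mc).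
  apply: (@preimage_closed _ _ (fun v : V => `|v|) [set r | r <= _]).
    by move=> v _; exact: norm_continuous.
  exact: closed_le.
have Ky : \forall k \near \oo, K (y k).
  by apply: nearW => k; rewrite /K /= le_max mP.
have Xoo : \forall k \near \oo, X (y k) by apply: nearW.
have cluster_sub : cluster (y @ \oo) `<=` [set xs].
  move=> z zP; have Xz : X z.
    apply: Xcl => U Uz; have [v [Xv Uv]] := zP X U Xoo Uz.
    by exists v.
  rewrite -argminE; split=> // v Xv.
  have [_ /(_ v Xv) xsv] : argmin X Phi xs by rewrite argminE.
  apply: le_trans xsv; rewrite leNgt; apply/negP => lt.
  have [a /andP[ea az]] :
      exists a : R, (0 < a) && ((Phi xs + a%:E)%E < Phi z)%E.
    move: lt; rewrite -(fineK finPhi); case: (Phi z) => [s||//] /=.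
      rewrite lte_fin => rs; exists ((s - fine (Phi xs)) / 2).
      by rewrite -EFinD lte_fin; apply/andP; split; lra.
    by move=> _; exists 1; rewrite ltr01 -EFinD ltry.
  have := lscPhi z (fine (Phi xs) + a) Xz; rewrite EFinD fineK// => /(_ az) Uz.
  have sub : \forall k \near \oo,
      (X `&` [set w | Phi w <= Phi xs + a%:E]%E) (y k).
    by have := yPhi a ea; apply: filterS => k; split.
  have [w /= [[Xw wle] /(_ Xw)]] := zP _ _ sub Uz.
  by rewrite ltNge wle.
refine (compact_cluster_set1 (@norm_hausdorff _ _) Kcpt _ _ Ky _).
- apply/nbhs_ballP; exists 1 => //= v; rewrite -ball_normE /= /K /= => xv.
  rewrite le_max; apply/orP; right.
  have := ler_normD xs (v - xs); rewrite subrKC distrC; lra.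
- apply/seteqP; split => // _ ->.
  have [z [Kz zP]] := Kcpt (y @ \oo) _ Ky.
  by rewrite -(cluster_sub z zP).
Qed.

(** Lower semicontinuity holds relative to X only, since the values of f outside
    X are arbitrary. *)
Lemma objective_lsc (M : nat) (X : set V) (g : V -> \bar R)
    (f : 'I_M -> V -> R) z (a : R) :
  (0 < M)%N -> eproper g -> lower_semicontinuous g ->
  (forall i, lower_semicontinuous (extend X (f i))) -> X z ->
  (a%:E < objective g f z)%E ->
  \forall v \near z, X v -> (a%:E < objective g f v)%E.
Proof.
move=> M0 [gN _] glsc flsc Xz aobj.
have fE i v : X v -> extend X (f i) v = (f i v)%:E.
  by move=> Xv; rewrite /extend /patch mem_set.
have lower e : 0 < e -> \forall v \near z, X v ->
    M%:R^-1 * \sum_(i < M) f i z - e <= M%:R^-1 * \sum_(i < M) f i v.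
  move=> e0; have near_i i : \forall v \near z, X v -> f i z - e < f i v.
    have [|U Uz UP] := flsc i z (f i z - e).
      by rewrite fE// lte_fin ltrBlDr ltrDl.
    near=> v => Xv; rewrite -lte_fin -(fE i v Xv); apply: UP.
    by near: v.
  near=> v => Xv.
  have lev : forall i, X v -> f i z - e < f i v.
    by near: v; exact: (filter_forall (F := nbhs z) _ near_i).
  have avg := average_le (fun i => f i z - f i v) e M0; move: avg.
  rewrite sumrB mulrBr => avg.
  suff: M%:R^-1 * \sum_(i < M) f i z - M%:R^-1 * \sum_(i < M) f i v <= e by lra.
  by apply: avg => i; have := lev i Xv; lra.
have gT (b : R) : (b%:E < g z)%E -> \forall v \near z, (b%:E < g v)%E.
  by case/glsc => U Uz UP; apply: filterS Uz.
(* Distribute the margin: e is lost on the average of the f i, and b is a strict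
   lower bound of g z, chosen large if g z = +oo. *)
suff [e [b [e0 bg ab]]] : exists e b, [/\ 0 < e, (b%:E < g z)%E &
    a <= M%:R^-1 * \sum_(i < M) f i z - e + b].
  near=> v => Xv; rewrite /objective.
  have bv : (b%:E < g v)%E by near: v; exact: gT.
  have lev : M%:R^-1 * \sum_(i < M) f i z - e <= M%:R^-1 * \sum_(i < M) f i v.
    by move: Xv; near: v; exact: lower.
  apply: (@le_lt_trans _ _ (M%:R^-1 * \sum_(i < M) f i v + b)%:E).
    by rewrite lee_fin; lra.
  by rewrite EFinD lteD2lE.
move: aobj (gN z); rewrite /objective; case: (g z) => [r||//] aobj _.
  move: aobj; rewrite -EFinD lte_fin => ar.
  exists ((M%:R^-1 * \sum_(i < M) f i z + r - a) / 2).
  exists (r - (M%:R^-1 * \sum_(i < M) f i z + r - a) / 2).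
  by split; rewrite ?lte_fin; lra.
exists 1, (a - M%:R^-1 * \sum_(i < M) f i z + 1); split; rewrite ?ltry//; lra.
Unshelve. all: by end_near. Qed.
End MinimizingSequence.

Theorem theorem1 (R : realType) (n M : nat) (hn : (1 <= n)%N) (hM : (1 <= M)%N)
  (X : set 'rV[R]_n) (h g : 'rV[R]_n -> \bar R)
  (f : 'I_M -> 'rV[R]_n -> R) (L : R) (hL : 0 < L)
  (h_proper : eproper h) (h_lsc : lower_semicontinuous h)
  (h_convex : econvex h) (h_legendre : legendre_type h)
  (h_dom : edom h = X)
  (X_closed : closed X) (X_convex : convex_set X) (X_int : X° !=set0)
  (g_proper : eproper g) (g_lsc : lower_semicontinuous g)
  (g_convex : econvex g) (g_dom : edom g `&` X° !=set0)
  (F_argmin_neq0 : argmin X (objective g f) !=set0)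
  (F_argmin_compact : compact (argmin X (objective g f)))
  (f_proper : forall i, eproper (extend X (f i)))
  (f_lsc : forall i, lower_semicontinuous (extend X (f i)))
  (f_convex : forall i, econvex (extend X (f i)))
  (f_diff : forall i x, (edom h)° x -> differentiable (f i) x)
  (f_smooth : forall i,
    convex_function (edom h)° (fun x => L * fine (h x) - f i x))
  (h_level : bregman_level_bounded h) (h_limit : bregman_limit h)
  (c : nat -> 'I_M) (c_finite : finite_answering_time c)
  (gamma : R) (hgamma : 0 < gamma < 1 / L)
  (xstar : 'rV[R]_n) (hxstar : argmin X (objective g f) = [set xstar])
  (x : nat -> 'rV[R]_n) (hx : async_bregman_prox_grad X h g f gamma c x) :
  x @ \oo --> xstar.
Proof.
subst X; set X := edom h in X_closed g_dom f_proper f_lsc f_convex hxstar hx *.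
have h_diff : forall w, X° w -> differentiable (fine \o h) w by case: h_legendre.
have gamma0 : 0 < gamma by case/andP: hgamma.
have [z [gz Xz]] := g_dom; have [x0 xmin] := hx.
have xint k : X° (x k).
  by case: k => [//|k]; exact: (prox_interior _ _ _ h_proper h_convex h_legendre
       g_proper g_convex gamma0 _ _ _ (xmin k.+1 isT) gz Xz).
have gx k : (0 < k)%N -> edom g (x k).
  move=> /xmin kmin.
  exact: (prox_edom_g _ _ _ h_proper g_proper gamma0 _ _ _ kmin gz Xz).
have [Xs Fs] : argmin X (objective g f) xstar by rewrite hxstar.
pose F v := M%:R^-1 * \sum_(i < M) f i v + fine (g v).
have objE v : edom g v -> objective g f v = (F v)%:E.
  by move=> gv; rewrite /objective -(edom_fin _ _ g_proper gv).
have gs : edom g xstar.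
  have := Fs z (interior_subset Xz); rewrite (objE z gz) /objective /edom/=.
  by case: (g xstar) (g_proper.1 xstar) => [r||] // _ _; exact: ltry.
pose a k := bregman h xstar (x k).
pose b k := gamma * (F (x k) - F xstar).
pose p i k := (k - delay2 c i k)%N.
have a0 k : 0 <= a k by exact: bregman_ge0.
have b0 k : (0 < k)%N -> 0 <= b k.
  move=> k0; rewrite mulr_ge0 ?(ltW gamma0)// subr_ge0 -lee_fin.
  rewrite -(objE _ gs) -(objE _ (gx k k0)).
  exact: (Fs _ (interior_subset (xint k))).
have plt i k : (0 < k)%N -> (p i k < k)%N by exact: sub_delay2_lt.
have ab k : (0 < k)%N -> a k + b k <= M%:R^-1 * \sum_(i < M) a (p i k).
  move=> k0.
  have opt := prox_optimality _ _ _ h_proper h_convex h_legendre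
    g_proper g_convex gamma0 _ _ _ (xmin k k0) gz Xz xstar gs Xs.
  have worker i := worker_progress_le _ h_proper h_convex h_diff L gamma (f i)
    xstar (x k) (x (p i k)) hgamma hL (f_proper i) (f_convex i) (f_smooth i) Xs (xint k)
    (xint _) (f_diff i _ (xint _)).
  have : M%:R^-1 * \sum_(i < M) dotp (grad (fine \o h) (x k) +
      (gamma *: grad (f i) (x (p i k)) - grad (fine \o h) (x (p i k))))
      (xstar - x k)
    <= M%:R^-1 *
       \sum_(i < M) (gamma * (f i xstar - f i (x k)) + a (p i k) - a k).
    by rewrite ler_pM2l ?invr_gt0 ?ltr0n//; apply: ler_sum => i _; exact: worker.
  have -> : M%:R^-1 * \sum_(i < M) dotp (grad (fine \o h) (x k) +
      (gamma *: grad (f i) (x (p i k)) - grad (fine \o h) (x (p i k))))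
      (xstar - x k)
    = dotp (grad (fine \o h) (x k) + update_direction h f gamma c x k)
        (xstar - x k).
    rewrite dotpC dotpDr /update_direction dotpZr dotp_sumr.
    under eq_bigr do rewrite dotpC dotpDr.
    by rewrite big_split mulrDr average_cst.
  rewrite sumrB mulrBr average_cst// big_split -mulr_sumr sumrB.
  rewrite mulrDr mulrCA mulrBr => avg.
  by move: (le_trans opt avg); rewrite /b /F !(mulrBr gamma) !(mulrDr gamma); lra.
have a_le k : a k <= a 0%N by exact: delayed_mean_bounded hM b0 plt ab k.
have xlim (y : nat -> 'rV[R]_n) : (forall k, X° (y k)) ->
    (y @ \oo --> xstar) <-> (bregman h xstar (y k) @[k --> \oo] --> (0 : R)).
  exact: h_limit.
apply/(xlim x xint).
have poo := sub_delay2_unbounded _ c_finite.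
apply: (delayed_mean_cvg0 _ _ _ hM a0 b0 plt poo ab).
(* If a small gap did not force a to be small, iterates with gap tending to 0
   would form a minimizing sequence that stays away from xstar. *)
move=> e e0; apply: contrapT => nod.
have bad l : exists k, [/\ (0 < k)%N, b k < l.+1%:R^-1 & e <= a k].
  apply: contrapT => nok; apply: nod; exists l.+1%:R^-1.
    by rewrite invr_gt0 ltr0n.
  move=> k k0 bk; rewrite ltNge; apply/negP => ek; apply: nok; by exists k.
have /choice[s sP] := bad.
have ys : (x \o s) @ \oo --> xstar.
  apply: (minimizing_sequence_cvg X (objective g f) xstar _ _ X_closed _ hxstar _
    (h_level xstar (a 0%N) Xs)).
  - by move=> v r Xv; apply: objective_lsc.
  - by rewrite (objE _ gs).
  - by move=> k; split; [exact: xint|exact: a_le].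
  - by move=> k; exact: interior_subset (xint _).
  move=> d d0; have gd0 : 0 < gamma * d by rewrite mulr_gt0.
  near=> k; have [sk0 bsk _] := sP k.
  rewrite (objE _ gs) (objE _ (gx _ sk0)) -EFinD lee_fin -lerBlDl.
  rewrite -(ler_pM2l gamma0); apply: le_trans (ltW bsk) _.
  apply/ltW; near: k; exact: (near_infty_natSinv_lt (PosNum gd0)).
have /(xlim _ (fun k => xint (s k)))/cvgr_lt/(_ e e0)[K _ /(_ K (leqnn K))/=] := ys.
by have [_ _] := sP K; rewrite leNgt => /negP.
Unshelve. all: by end_near. Qed.
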